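(* Let $N_0,M_0\in\mathbb{N}$ and let $\mathcal{T}$ be a random variable with support in $[a,b]$, where $a\ge 0$, and with mean $\mu>0$. Then $$\lim_{N\to\infty}\mathbb{P}\left(\frac{b}{\mu}\,LB_M^+\bigl(\mathcal{I}(N,M_0,\mathcal{T})\bigr)\ge OPT\bigl(\mathcal{I}(N,M_0,\mathcal{T})\bigr)\right)=1,$$ $$\lim_{M\to\infty}\mathbb{P}\left(\frac{b}{\mu}\,LB_J^+\bigl(\mathcal{I}(N_0,M,\mathcal{T})\bigr)\ge OPT\bigl(\mathcal{I}(N_0,M,\mathcal{T})\bigr)\right)=1.$$
   Context: Permutation Flowshop Scheduling Problem (PFSP): an instance consists of $N\ge 1$ jobs, $M\ge 1$ machines, and a matrix of constant non-negative processing times $t_{i,j}$ ($1\le i\le M$, $1\le j\le N$), where $t_{i,j}$ is the processing time of job $j$ on machine $i$. A schedule is a permutation $\pi=(\pi_1,\dots,\pi_N)$ of the jobs. For a given $\pi$ the completion times $C_{i,j}$ are defined by $C_{1,\pi_1}=t_{1,\pi_1}$; $C_{i,\pi_1}=t_{i,\pi_1}+C_{i-1,\pi_1}$ for $1<i\le M$; $C_{1,\pi_j}=t_{1,\pi_j}+C_{1,\pi_{j-1}}$ for $1<j\le N$; and $C_{i,\pi_j}=t_{i,\pi_j}+\max\{C_{i-1,\pi_j},C_{i,\pi_{j-1}}\}$ otherwise. The makespan is $C_{max}(\pi)=C_{M,\pi_N}$, and $OPT(I)=\min_\pi C_{max}(\pi)$ is the minimum makespan of the instance $I$. For $N,M\in\mathbb{N}$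 (positive integers) and a random variable $\mathcal{T}$, $\mathcal{I}(N,M,\mathcal{T})$ denotes the random instance with $N$ jobs and $M$ machines whose processing times $T_{i,j}$ are independent and identically distributed with the same distribution as $\mathcal{T}$. For an instance define $$LB_M^+=\max_{1\le i\le M}\left\{\min_{1\le j\le N}\sum_{i'<i}t_{i',j}+\sum_{1\le j\le N}t_{i,j}+\min_{1\le j\le N}\sum_{i'>i}t_{i',j}\right\},$$ $$LB_J^+=\max_{1\le j\le N}\left\{\sum_{1\le i\le M}t_{i,j}+\sum_{j'\ne j}\min\{t_{1,j'},t_{M,j'}\}\right\}.$$ *)

(* Defs.v *)
From HB Require Import structures.
From mathcomp Require Import all_boot all_order all_algebra all_fingroup.
From mathcomp Require Import all_classical all_reals all_analysis.
Set Implicit Arguments.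
Unset Strict Implicit.
Unset Printing Implicit Defensive.
Import Order.TTheory GRing.Theory Num.Theory.
Import numFieldNormedType.Exports.
Local Open Scope classical_set_scope.
Local Open Scope ring_scope.

(* Minimum and maximum over an inhabited finite type; the value at i0, which
   is one of the values of F, only serves as the seed of the iteration. *)
Definition fin_min (R : realType) (I : finType) (i0 : I) (F : I -> R) : R :=
  \big[Num.min/F i0]_(i : I) F i.

Definition fin_max (R : realType) (I : finType) (i0 : I) (F : I -> R) : R :=
  \big[Num.max/F i0]_(i : I) F i.

(* A permutation flowshop instance with M = m.+1 machines and N = n.+1 jobs is
   the matrix t of processing times: t i j is the processing time of job j on
   machine i.  Machines, jobs and positions are numbered from 0, so ord0 and
   ord_max are the first and the last one. *)
Section Flowshop.
Variables (R : realType) (m n : nat).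
Implicit Types (t : 'M[R]_(m.+1, n.+1)) (s : 'S_n.+1).

(* Processing time, on machine i, of the job in position k of the schedule s;
   only used for i <= m and k <= n, where inord does not truncate. *)
Definition sched_time t s (i k : nat) : R := t (inord i) (s (inord k)).

(* completion_time t s i k is the completion time on machine i of the job in
   position k of s, that is C_{i, s_k}. *)
Fixpoint completion_time t s (i : nat) : nat -> R :=
  match i with
  | 0%N =>
      fix C0 (k : nat) : R :=
        match k with
        | 0%N => sched_time t s 0 0
        | k'.+1 => sched_time t s 0 k'.+1 + C0 k'
        end
  | i'.+1 =>
      fix Ci (k : nat) : R :=
        match k with
        | 0%N => sched_time t s i'.+1 0 + completion_time t s i' 0
        | k'.+1 => sched_time t s i'.+1 k'.+1
                   + Num.max (completion_time t s i' k'.+1) (Ci k')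
        end
  end.

Definition makespan t s : R := completion_time t s m n.

Definition OPT t : R := fin_min (1%g : 'S_n.+1) (makespan t).

Definition LBMplus t : R :=
  fin_max ord0 (fun i : 'I_m.+1 =>
      fin_min ord0 (fun j : 'I_n.+1 => \sum_(i' < m.+1 | (i' < i)%N) t i' j)
      + \sum_(j < n.+1) t i j
      + fin_min ord0 (fun j : 'I_n.+1 => \sum_(i' < m.+1 | (i < i')%N) t i' j)).

Definition LBJplus t : R :=
  fin_max ord0 (fun j : 'I_n.+1 =>
      \sum_(i < m.+1) t i j
      + \sum_(j' < n.+1 | j' != j) Num.min (t ord0 j') (t ord_max j')).

End Flowshop.

(* Topological support of a Borel probability measure on the line. *)
Definition support_of (R : realType) (nu : probability R R) : set R :=
  [set x | forall U : set R, open U -> U x -> (0 < nu U)%E].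

Definition mutually_independent d (W : measurableType d) (R : realType)
    (P : probability W R) (I : finType) (X : I -> {RV P >-> R}) : Prop :=
  forall (J : {set I}) (A : I -> set R), (forall k, measurable (A k)) ->
    P [set w | forall k, k \in J -> A k (X k w)]
    = (\prod_(k in J) P (X k @^-1` A k))%E.

Definition same_distribution d (W : measurableType d) d' (W' : measurableType d')
    (R : realType) (P : probability W R) (Q : probability W' R)
    (X : {RV P >-> R}) (T : {RV Q >-> R}) : Prop :=
  forall A : set R, measurable A -> distribution P X A = distribution Q T A.

(* X is (a realization, on the probability space (W, P), of) the random
   instance I(n.+1, m.+1, T). *)
Definition random_instance d (W : measurableType d) d' (W' : measurableType d')
    (R : realType) (P : probability W R) (Q : probability W' R) (m n : nat)
    (T : {RV Q >-> R}) (X : 'I_m.+1 -> 'I_n.+1 -> {RV P >-> R}) : Prop :=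
  mutually_independent (fun ij : 'I_m.+1 * 'I_n.+1 => X ij.1 ij.2)
  /\ (forall i j, same_distribution (X i j) T).

Definition outcome d (W : measurableType d) (R : realType)
    (P : probability W R) (m n : nat)
    (X : 'I_m.+1 -> 'I_n.+1 -> {RV P >-> R}) (w : W) : 'M[R]_(m.+1, n.+1) :=
  \matrix_(i, j) X i j w.

(* Main.v *)
Require Import Defs.
From HB Require Import structures.
From mathcomp Require Import all_boot all_order all_algebra all_fingroup.
From mathcomp Require Import all_classical all_reals all_analysis.
From mathcomp Require Import measurable_realfun.
From mathcomp Require Import ring lra.
Import Order.TTheory GRing.Theory Num.Theory.
Import numFieldNormedType.Exports.
Local Open Scope classical_set_scope.
Local Open Scope ring_scope.

Set Implicit Arguments.
Unset Strict Implicit.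

(** Completion times obey a recursion that is symmetric in machines and jobs,
    so both limits are instances of one statement ([approximation_cvg1]) about
    an array with a fixed number [r.+1] of lines and [n.+1] columns, [n] going
    to infinity: the lines are the machines for LB_M^+ and the jobs for LB_J^+.

    Suppose that in every line each partial sum of [k] entries is within [e] of
    [k * mu].  Continuing along a line of the array costs one entry, that is,
    one step of the partial sum of that line; changing lines costs one entry,
    at most [b], and replaces one partial sum by another, which differs by at
    most [2 * e].  Hence the completion times of the identity schedule are at
    most the partial sums plus [2 * e + b] per line crossed
    ([typical_supersolution]), so OPT is at most [n.+1 * mu + O(e + b)].  Each
    lower bound is at least the sum of a line, [n.+1 * mu - e].  If [mu < b],
    multiplication by [b / mu] gains [n.+1 * (b - mu)], which absorbs every
    error term once [e] is a small multiple of [n.+1] ([typical_opt_le]).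

    That all partial sums are close to their means with probability tending to
    [1] is a uniform weak law of large numbers.  It suffices to control [K.+1]
    equally spaced partial sums per line, as the others are close to these
    ([partial_sum_grid]); by Chebyshev's inequality each of the finitely many
    control events fails with probability O(1/n) ([chebyshev_sum_le]).  The
    vanishing of the covariances comes from the joint law of two independent
    variables being a product measure, and Fubini's theorem.

    If [mu = b] there is no gain to spend, but then almost surely all
    processing times equal [b] ([mean_eq_bound_ae]), and OPT is at most the
    lower bound ([constant_opt_le]). *)

(** * Extrema and sums over finite types *)

Section FinExtrema.
Variables (R : realType) (I : finType) (i0 : I).

Lemma fin_min_le (F : I -> R) i : fin_min i0 F <= F i.
Proof. exact: bigmin_le_cond. Qed.

Lemma le_fin_min (c : R) (F : I -> R) :
  (forall i, c <= F i) -> c <= fin_min i0 F.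
Proof. by move=> cF; apply/bigmin_geP; split. Qed.

Lemma le_fin_max (F : I -> R) i : F i <= fin_max i0 F.
Proof. exact: le_bigmax_cond. Qed.

Lemma measurable_fin_min d (T : measurableType d) (F : T -> I -> R) :
  (forall i, measurable_fun setT (F^~ i)) ->
  measurable_fun setT (fun x => fin_min i0 (F x)).
Proof.
move=> mF; rewrite /fin_min; elim: (index_enum I) => [|i s IH].
  by under eq_fun do rewrite big_nil; exact: mF.
by under eq_fun do rewrite big_cons; apply: measurable_minr;
  [exact: mF|exact: IH].
Qed.

Lemma measurable_fin_max d (T : measurableType d) (F : T -> I -> R) :
  (forall i, measurable_fun setT (F^~ i)) ->
  measurable_fun setT (fun x => fin_max i0 (F x)).
Proof.
move=> mF; rewrite /fin_max; elim: (index_enum I) => [|i s IH].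
  by under eq_fun do rewrite big_nil; exact: mF.
by under eq_fun do rewrite big_cons; apply: measurable_maxr;
  [exact: mF|exact: IH].
Qed.

End FinExtrema.

Lemma measurable_finsum (R : realType) d (T : measurableType d) (I : finType)
    (p : pred I) (F : T -> I -> R) :
  (forall i, measurable_fun setT (F^~ i)) ->
  measurable_fun setT (fun x => \sum_(i | p i) F x i).
Proof.
move=> mF; elim: (index_enum I) => [|i s IH].
  by under eq_fun do rewrite big_nil; exact: measurable_cst.
under eq_fun do rewrite big_cons.
by case: (p i); [apply: measurable_funD; [exact: mF|exact: IH]|exact: IH].
Qed.

(** * Partial sums of a line *)

Section PartialSums.
Variables (R : realType) (n : nat).
Implicit Types x : 'I_n.+1 -> R.

Definition partial_sum x (k : nat) : R := \sum_(j < n.+1 | (j < k)%N) x j.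

Lemma partial_sum0 x : partial_sum x 0 = 0.
Proof. exact: big_pred0. Qed.

Lemma partial_sumS x k : (k <= n)%N ->
  partial_sum x k.+1 = partial_sum x k + x (inord k).
Proof.
move=> kn; rewrite /partial_sum (bigD1 (inord k)) /= ?inordK// addrC.
congr (_ + _).
by apply: eq_bigl => j; rewrite ltnS ltn_neqAle -val_eqE /= inordK// andbC.
Qed.

Lemma partial_sum_full x : partial_sum x n.+1 = \sum_j x j.
Proof. by apply: eq_bigl => j; rewrite ltn_ord. Qed.

Lemma partial_sum_shift x mu k : (k <= n.+1)%N ->
  partial_sum (fun j => x j - mu) k = partial_sum x k - k%:R * mu.
Proof.
elim: k => [|k IH] kn; first by rewrite !partial_sum0 mul0r subr0.
by rewrite !partial_sumS// IH ?(ltnW kn)// mulrSr mulrDl mul1r; ring.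
Qed.

Lemma partial_sum_lipschitz x (b : R) k l : (forall j, `|x j| <= b) ->
  (k + l <= n.+1)%N -> `|partial_sum x (k + l) - partial_sum x k| <= l%:R * b.
Proof.
move=> xb; elim: l => [|l IH] kn; first by rewrite addn0 subrr normr0 mul0r.
move: kn; rewrite addnS ltnS => kn; rewrite partial_sumS// mulrSr mulrDl mul1r.
rewrite addrAC (le_trans (ler_normD _ _))// lerD ?xb//.
by rewrite IH// ltnW.
Qed.

End PartialSums.

(** The block length [B] exceeds [n.+1 / K.+1], so the first [K.+1] multiples
    of [B] come within [B] below every [k <= n.+1]. *)
Lemma partial_sum_grid (R : realType) n (x : 'I_n.+1 -> R) (b e : R) (K : nat) :
  let B := (n.+1 %/ K.+1).+1 in
  (forall j, `|x j| <= b) ->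
  (forall l : 'I_K.+1, `|partial_sum x (l * B)| <= e) ->
  forall k, (k <= n.+1)%N -> `|partial_sum x k| <= e + B%:R * b.
Proof.
move=> B xb xe k kn.
have b0 : 0 <= b by exact: le_trans (xb ord0).
have Bgt0 : (0 < B)%N by [].
have lK : (k %/ B < K.+1)%N.
  by rewrite ltn_divLR// (leq_ltn_trans kn)// mulnC -ltn_divLR.
have := xe (Ordinal lK) => /= xl.
have := @partial_sum_lipschitz _ _ x b (k %/ B * B) (k %% B) xb.
rewrite -divn_eq => /(_ kn) xk.
rewrite -[partial_sum x k](subrK (partial_sum x (k %/ B * B))) addrC.
apply: le_trans (ler_normD _ _) _; apply: lerD => //.
by apply: le_trans xk _; rewrite ler_wpM2r// ler_nat ltnW// ltn_mod.
Qed.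

(** * Upper bounds on the optimal makespan *)

Lemma inord_ord0 k : inord 0 = ord0 :> 'I_k.+1.
Proof. by apply/val_inj; rewrite /= inordK. Qed.

Section Supersolution.
Variables (R : realType) (r n : nat).

(** For the matrix of processing times, the completion times of the identity
    schedule form the least such [V]: the maximum in their recursion amounts
    to the two inequalities. *)
Definition supersolution (x : 'I_r.+1 -> 'I_n.+1 -> R) (V : nat -> nat -> R) :=
  [/\ x ord0 ord0 <= V 0%N 0%N,
   forall p q, (p <= r)%N -> (q < n)%N ->
     x (inord p) (inord q.+1) + V p q <= V p q.+1 &
   forall p q, (p < r)%N -> (q <= n)%N ->
     x (inord p.+1) (inord q) + V p q <= V p.+1 q].

(** Comparison principle, applied to the identity schedule, which with
    high probability already stays below [b / mu] times the lower bounds. *)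
Lemma OPT_le_supersolution (t : 'M[R]_(r.+1, n.+1)) V :
  supersolution (fun i j => t i j) V -> OPT t <= V r n.
Proof.
move=> [V00 Vr Vd]; apply: le_trans (fin_min_le _ _ 1%g) _.
suff H i k : (i <= r)%N -> (k <= n)%N -> completion_time t 1 i k <= V i k.
  exact: H.
elim: i k => [|i IHi]; elim=> [|k IHk] ir kn /=.
- by rewrite /sched_time perm1 !inord_ord0.
- apply: le_trans (Vr _ _ ir kn); rewrite /sched_time perm1.
  by rewrite lerD2l IHk// ltnW.
- apply: le_trans (Vd _ _ ir kn); rewrite /sched_time perm1.
  by rewrite lerD2l IHi// ltnW.
- rewrite maxEle /sched_time perm1; case: ifP => _.
    apply: le_trans (Vr _ _ ir kn); rewrite lerD2l.
    by apply: IHk; rewrite // ltnW.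
  apply: le_trans (Vd _ _ ir kn); rewrite lerD2l.
  by apply: IHi; rewrite // ltnW.
Qed.

End Supersolution.

Lemma supersolution_tr (R : realType) r n (x : 'I_r.+1 -> 'I_n.+1 -> R) V :
  supersolution x V -> supersolution (fun j i => x i j) (fun q p => V p q).
Proof. by move=> [V0 Vr Vd]; split=> // p q ? ?; [exact: Vd|exact: Vr]. Qed.

(** * The lower bounds *)

Section LowerBounds.
Variables (R : realType) (m n : nat) (t : 'M[R]_(m.+1, n.+1)) (c : R).
Hypotheses (c0 : 0 <= c) (ct : forall i j, c <= t i j).

Lemma card_ord_pos k : #|[pred i : 'I_k.+1 | (0 < i)%N]| = k.
Proof.
have -> : #|[pred i : 'I_k.+1 | (0 < i)%N]| = #|predC1 (ord0 : 'I_k.+1)|.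
  by apply: eq_card => i; rewrite !inE lt0n -val_eqE.
by rewrite cardC1 card_ord.
Qed.

(** The term of the first machine: nothing precedes it, and each job still has
    to visit the [m] other machines.  With [c = 0] this is the plain sum of a
    line; with [c] the common value of all entries it is sharp. *)
Lemma LBMplus_ge : \sum_j t ord0 j + m%:R * c <= LBMplus t.
Proof.
apply: le_trans (le_fin_max _ _ ord0); apply: lerD.
  rewrite lerDr; apply: le_fin_min => j; apply: sumr_ge0 => i _.
  exact: le_trans c0 _.
apply: le_fin_min => j; rewrite -[X in X%:R * _](card_ord_pos m).
by rewrite mulr_natl -sumr_const; apply: ler_sum => i _.
Qed.

Lemma LBJplus_ge : \sum_i t i ord0 + n%:R * c <= LBJplus t.
Proof.
apply: le_trans (le_fin_max _ _ ord0); apply: lerD => //.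
rewrite -[X in X%:R * _](card_ord_pos n) mulr_natl -sumr_const.
rewrite [leLHS](eq_bigl (fun j : 'I_n.+1 => j != ord0)); last first.
  by move=> j; rewrite !inE lt0n -val_eqE.
by apply: ler_sum => i _; rewrite le_min !ct.
Qed.

End LowerBounds.

(** * Measurability of the optimum and of the lower bounds *)

Section Measurability.
Variables (R : realType) (m n : nat) (d : measure_display).
Variables (T : measurableType d) (t : T -> 'M[R]_(m.+1, n.+1)).
Hypothesis mt : forall i j, measurable_fun setT (fun w => t w i j).

Lemma measurable_OPT : measurable_fun setT (fun w => OPT (t w)).
Proof.
apply: measurable_fin_min => s; rewrite /makespan.
suff H i k : measurable_fun setT (fun w => completion_time (t w) s i k).
  exact: H.
elim: i k => [|i IHi]; elim=> [|k IHk] /=; rewrite /sched_time //.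
- exact: measurable_funD.
- exact: measurable_funD.
- by apply: measurable_funD => //; exact: measurable_maxr.
Qed.

Lemma measurable_LBMplus : measurable_fun setT (fun w => LBMplus (t w)).
Proof.
apply: measurable_fin_max => i; apply: measurable_funD.
  apply: measurable_funD; last exact: measurable_finsum.
  by apply: measurable_fin_min => j; exact: measurable_finsum.
by apply: measurable_fin_min => j; exact: measurable_finsum.
Qed.

Lemma measurable_LBJplus : measurable_fun setT (fun w => LBJplus (t w)).
Proof.
apply: measurable_fin_max => i; apply: measurable_funD.
  exact: measurable_finsum.
by apply: measurable_finsum => j; exact: measurable_minr.
Qed.

End Measurability.

(** * Comparison on a typical array *)

(** The partial sums are centred before the absolute value is taken, which is
    the form that Chebyshev's inequality bounds. *)
Definition typical (R : realType) r n (b mu e : R)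
    (x : 'I_r.+1 -> 'I_n.+1 -> R) :=
  (forall i j, 0 <= x i j <= b) /\
  (forall i k, (k <= n.+1)%N -> `|partial_sum (fun j => x i j - mu) k| <= e).

Section Deterministic.
Variables (R : realType) (r n : nat) (x : 'I_r.+1 -> 'I_n.+1 -> R).

(** All that the comparison uses of the optimum and of a lower bound of an
    instance.  The lines of the array may be the machines or the jobs, so that
    both lower bounds are treated at once. *)
Definition flow_bounds (opt lb : R) :=
  (forall V, supersolution x V -> opt <= V r n) /\
  (forall c : R, 0 <= c -> (forall i j, c <= x i j) ->
     \sum_j x ord0 j + r%:R * c <= lb).

(** Along a line the partial sum absorbs the new entry exactly; from a line to
    the next one, both partial sums of [q.+1] entries are within [e] of
    [q.+1 * mu], and the new entry is at most [b]. *)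
Lemma typical_supersolution (b mu e : R) : typical b mu e x ->
  supersolution x
    (fun p q => partial_sum (x (inord p)) q.+1 + p%:R * (2 * e + b)).
Proof.
move=> [xb xe]; split.
- by rewrite partial_sumS// partial_sum0 mul0r addr0 add0r !inord_ord0.
- move=> p q _ qn; rewrite [in leRHS]partial_sumS// addrA.
  by rewrite [_ + partial_sum _ _]addrC.
- move=> p q _ qn; have /andP[_ xpb] := xb (inord p.+1) (inord q).
  have := xe (inord p) q.+1 qn; have := xe (inord p.+1) q.+1 qn.
  rewrite !partial_sum_shift// !ler_norml => /andP[? _] /andP[_ ?].
  by rewrite [p.+1%:R]mulrSr; lra.
Qed.

(** The factor of [e] collects [b / mu] from the lower bound, [1] from the
    last line in the upper bound, and [2] for each of the [r] changes of
    line. *)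
Lemma typical_opt_le (b mu e opt lb : R) : 0 < mu -> flow_bounds opt lb ->
    typical b mu e x ->
    (b / mu + 1 + 2 * r%:R) * e + r%:R * b <= n.+1%:R * (b - mu) ->
  opt <= b / mu * lb.
Proof.
move=> mu0 [optV lbc] tx ineq.
have b0 : 0 <= b.
  by case: tx => /(_ ord0 ord0)/andP[x0 xb] _; exact: le_trans xb.
apply: le_trans (optV _ (typical_supersolution tx)) _.
case: tx => xb xe.
have := lbc 0 (lexx _) (fun i j => proj1 (andP (xb i j))).
have := xe (inord r) n.+1 (leqnn _); have := xe ord0 n.+1 (leqnn _).
rewrite !partial_sum_shift// !partial_sum_full !ler_norml.
move=> /andP[S0 _] /andP[_ Sr] Slb.
have : b / mu * (n.+1%:R * mu - e) <= b / mu * lb.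
  by rewrite ler_wpM2l ?divr_ge0 ?(ltW mu0)//; lra.
apply: le_trans.
rewrite mulrBr mulrCA -[b / mu * mu]mulrA mulVf ?mulr1 ?gt_eqF//.
lra.
Qed.

(** Every path through the array has [r + n + 1] entries, whence the
    supersolution [(p + q).+1 * b]. *)
Lemma constant_opt_le (b opt lb : R) : 0 <= b -> flow_bounds opt lb ->
  (forall i j, x i j = b) -> opt <= lb.
Proof.
move=> b0 [optV lbc] xb.
apply: le_trans (optV (fun p q => (p + q).+1%:R * b) _) _.
  split=> [|p q _ _|p q _ _]; rewrite xb ?mul1r//.
    by rewrite addnS [in leRHS]mulrSr mulrDl mul1r addrC.
  by rewrite addSn [in leRHS]mulrSr mulrDl mul1r addrC.
apply: le_trans (lbc b b0 _); last by move=> i j; rewrite xb.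
under eq_bigr do rewrite xb.
rewrite sumr_const card_ord -(mulr_natl b) -mulrDl -natrD.
by rewrite addSn [(n + _)%N]addnC.
Qed.

End Deterministic.

Lemma flow_bounds_LBMplus (R : realType) m n (t : 'M[R]_(m.+1, n.+1)) :
  flow_bounds (fun i j => t i j) (OPT t) (LBMplus t).
Proof.
by split=> [V|c c0 ct]; [exact: OPT_le_supersolution|exact: LBMplus_ge].
Qed.

Lemma flow_bounds_LBJplus (R : realType) m n (t : 'M[R]_(m.+1, n.+1)) :
  flow_bounds (fun j i => t i j) (OPT t) (LBJplus t).
Proof.
split=> [V /supersolution_tr|c c0 ct]; first exact: OPT_le_supersolution.
by apply: LBJplus_ge => // i j.
Qed.

(** * Null sets and unions *)

(** A point off the support has a neighbourhood of measure zero, hence lies in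
    an interval with rational end points of measure zero; there are countably
    many of these. *)
Lemma support_of_null (R : realType) (nu : probability R R) (U : set R) :
  open U -> U `&` support_of nu = set0 -> nu U = 0%E.
Proof.
move=> oU US; apply: measure_negligible; first exact: open_measurable.
(* the null intervals with rational end points, enumerated by pickling *)
pose J (pq : rat * rat) : set R := `]ratr pq.1, ratr pq.2[%classic.
pose F k := if unpickle k is Some pq then
  if nu (J pq) == 0%E then J pq else set0 else set0.
apply: negligibleS (negligible_bigcup (F := F) _) => [x Ux|k]; last first.
  rewrite /F; case: unpickle => [pq|]; last exact: negligible_set0.
  case: eqP => [nu0|_]; last exact: negligible_set0.
  by apply/negligibleP => //; exact: measurable_itv.
have : ~ support_of nu x by move=> Sx; have : set0 x by rewrite -US; split.
move=> /existsNP[V /not_implyP[oV /not_implyP[Vx]]].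
move=> /negP; rewrite -leNgt measure_le0 => /eqP nuV.
have /nbhs_ballP[e /= e0 eV] : nbhs x V by exact: open_nbhs_nbhs.
have /rat_in_itvoo[p /itvP pP] : x - e < x by rewrite ltrBlDr ltrDl.
have /rat_in_itvoo[q /itvP qP] : x < x + e by rewrite ltrDl.
suff nuJ : nu (J (p, q)) = 0%E.
  exists (pickle (p, q)); first exact: I.
  by rewrite /F pickleK nuJ eqxx /J /= in_itv /= pP qP.
apply/eqP; rewrite -measure_le0 -nuV; apply: le_measure.
- by rewrite inE; exact: measurable_itv.
- by rewrite inE; exact: open_measurable.
move=> y; rewrite /J /= in_itv /= => /andP[py yq]; apply: eV.
have xp : x - e < ratr p by rewrite pP.
have qx : ratr q < x + e by rewrite qP.
by rewrite /ball /= ltr_norml; apply/andP; split; lra.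
Qed.

Lemma probability_finite_union_le d (W : measurableType d) (R : realType)
    (P : probability W R) (I : finType) (B : I -> set W) :
  (forall i, measurable (B i)) ->
  (P (\big[setU/set0]_i B i) <= \sum_i P (B i))%E.
Proof.
move=> mB; elim: (index_enum I) => [|i s IH].
  by rewrite !big_nil measure0.
have mU : measurable (\big[setU/set0]_(j <- s) B j).
  exact: bigsetU_measurable.
rewrite !big_cons; apply: le_trans (measureU2 P (mB i) mU) _.
exact: leeD2l.
Qed.

(** Only an upper bound on the failure probability is available: failure is
    contained in an event [B] that need not be failure itself. *)
Lemma probability_cvg1 (R : realType) (d : nat -> measure_display)
    (W : forall n, measurableType (d n)) (P : forall n, probability (W n) R)
    (E B : forall n, set (W n)) (c : R) :
  (forall n, measurable (E n)) -> (forall n, measurable (B n)) ->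
  (\forall n \near \oo, ~` E n `<=` B n /\ (P n (B n) <= (c / n.+1%:R)%:E)%E) ->
  (fun n => P n (E n)) @ \oo --> 1%E.
Proof.
move=> mE mB EB.
apply: (@squeeze_cvge _ _ _ _ (fun n => (1 - c * harmonic n)%:E) _ (cst 1%E)).
- apply: filterS EB => n [EB PB]; rewrite probability_le1// andbT.
  have -> : P n (E n) = (1 - P n (~` E n))%E.
    by rewrite -[in LHS](setCK (E n)) probability_setC//; exact: measurableC.
  rewrite EFinB leeB//; apply: le_trans PB.
  by apply: le_measure => //; rewrite inE//; exact: measurableC.
- apply: cvg_EFin; first exact: nearW.
  rewrite -[X in _ --> X](subr0 1) -[X in 1 - X](mulr0 c).
  apply: cvgB; first exact: cvg_cst.
  by apply: cvgM; [exact: cvg_cst|exact: cvg_harmonic].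
- exact: cvg_cst.
Qed.

(** * Chebyshev's inequality for pairwise independent variables *)

Section SecondMoment.
Local Open Scope ereal_scope.
Context d (W : measurableType d) (R : realType) (P : probability W R).
Variables (nu : probability R R) (g : R -> R) (b : R).
Hypotheses (mg : measurable_fun setT g) (gb : forall x, (`|g x| <= b)%R).
Hypothesis (g0 : \int[nu]_x (g x)%:E = 0).

Let bounded_integrable d' (V : measurableType d')
    (rho : {measure set V -> \bar R}) (f : V -> R) (c : R) :
  rho setT = 1 -> measurable_fun setT f -> (forall v, `|f v| <= c)%R ->
  rho.-integrable setT (EFin \o f).
Proof.
move=> rho1 mf fc; apply: measurable_bounded_integrable => //.
  by rewrite rho1 ltry.
exists c; split; first exact: num_real.
by move=> M cM v _ /=; exact: le_trans (ltW cM).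
Qed.

(** The joint law of [X] and [Y] is the product of the marginals, since the two
    agree on rectangles; integrate first over the second variable. *)
Lemma independent_centered_orthogonal (X Y : {RV P >-> R}) :
  (forall A B, measurable A -> measurable B ->
     P (X @^-1` A `&` Y @^-1` B) = nu A * nu B) ->
  \int[P]_w (g (X w) * g (Y w))%:E = 0.
Proof.
move=> XY; pose XYpair w := (X w, Y w).
have mXY : measurable_fun setT XYpair by exact: measurable_fun_pair.
pose f (z : R * R) := (g z.1 * g z.2)%R.
have mf : measurable_fun setT f.
  by apply: measurable_funM; apply: measurableT_comp.
have fb z : (`|f z| <= b * b)%R by rewrite normrM ler_pM.
have -> : \int[P]_w (g (X w) * g (Y w))%:E
    = \int[pushforward P XYpair]_z (EFin \o f) z.
  rewrite integral_pushforward//; first exact/measurable_EFinP.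
  rewrite preimage_setT.
  apply: (@bounded_integrable _ _ P (f \o XYpair) (b * b)%R).
  - exact: probability_setT.
  - exact: measurableT_comp.
  - by move=> w; exact: fb.
rewrite (eq_measure_integral (nu \x nu)%E); last first.
  move=> A mA _; apply/esym; apply: product_measure_unique => //.
rewrite -integral12_prod_meas1/=; last first.
  have nu21 : (nu \x nu) [set: R * R] = 1.
    rewrite -setXTT product_measure1E//.
    by rewrite -[RHS]mule1; congr (_ * _); exact: probability_setT.
  by apply: (@bounded_integrable _ _ (nu \x nu) f (b * b)%R).
apply: integral0_eq => x _; rewrite /fubini_F /= /f /=.
under eq_integral do rewrite EFinM.
rewrite integralZl ?g0 ?mule0//.
by apply: (@bounded_integrable _ _ nu g b) => //; exact: probability_setT.
Qed.

(** Expanding the square, only the diagonal terms survive, and there are at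
    most [#|I|] of them. *)
Lemma second_moment_le (I : finType) (p : pred I) (X : I -> {RV P >-> R}) :
  (forall i j A B, i != j -> measurable A -> measurable B ->
     P (X i @^-1` A `&` X j @^-1` B) = nu A * nu B) ->
  \int[P]_w ((\sum_(i | p i) g (X i w)) ^+ 2)%:E
    <= (#|I|%:R * b ^+ 2)%:E.
Proof.
move=> indep.
have int_gg i j : P.-integrable setT (fun w => (g (X i w) * g (X j w))%:E).
  apply: (@bounded_integrable _ _ P (fun w => g (X i w) * g (X j w))%R (b*b)%R).
  - exact: probability_setT.
  - by apply: measurable_funM; apply: measurableT_comp.
  - by move=> w; rewrite normrM ler_pM.
under eq_integral do rewrite expr2 big_distrlr /= -sumEFin.
under eq_integral do under eq_bigr do rewrite -sumEFin.
rewrite integral_sum//; last by move=> i; exact: integrable_sum.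
rewrite [leLHS](eq_bigr (fun i => \int[P]_w (g (X i w) * g (X i w))%:E)).
  rewrite mulr_natl -sumr_const -sumEFin.
  apply: (@le_trans _ _ (\sum_(i | p i) (b ^+ 2)%:E)).
    apply: lee_sum => i _.
    have -> : (b ^+ 2)%:E = \int[P]_w cst (b ^+ 2)%:E w.
      by rewrite integral_cst//= probability_setT mule1.
    apply: ge0_le_integral => //.
    - by move=> w _; rewrite lee_fin -expr2 sqr_ge0.
    - apply/measurable_EFinP.
      by apply: measurable_funM; apply: measurableT_comp.
    - by move=> w _; rewrite lee_fin -expr2 -ler_sqrt ?sqr_ge0// !sqrtr_sqr
        (le_trans (gb _))// ler_norm.
  rewrite [leRHS](bigID p)/= leeDl//.
  by apply: sume_ge0 => i _; rewrite lee_fin sqr_ge0.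
move=> i pi; rewrite integral_sum// (bigD1 i)//= big1 ?adde0//.
move=> j /andP[_ ji]; apply: independent_centered_orthogonal.
by move=> A B; apply: indep; rewrite eq_sym.
Qed.

Lemma chebyshev_sum_le (I : finType) (p : pred I) (X : I -> {RV P >-> R})
    (e : R) : (0 < e)%R ->
  (forall i j A B, i != j -> measurable A -> measurable B ->
     P (X i @^-1` A `&` X j @^-1` B) = nu A * nu B) ->
  P [set w | (e <= `|\sum_(i | p i) g (X i w)|)%R]
    <= (#|I|%:R * b ^+ 2 / e ^+ 2)%:E.
Proof.
move=> e0 indep; pose S w := (\sum_(i | p i) g (X i w))%R.
have mS : measurable_fun setT S.
  by apply: measurable_finsum => i; apply: measurableT_comp.
have := @le_integral_comp_abse _ _ _ P setT measurableT (EFin \o S) e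
  (fun x => x * x).
rewrite setTI => /(_ _ _ _ _ e0) markov.
rewrite EFinM -[(_ ^- 2)%:E]/(((e ^+ 2)^-1)%:E).
rewrite lee_pdivlMr ?exprn_gt0// muleC expr2 EFinM.
apply: le_trans (second_moment_le p indep).
apply: le_trans (markov _ _ _ _) _.
- exact: emeasurable_funM.
- by move=> x x0; exact: mule_ge0.
- move=> x y; rewrite !inE /= !in_itv /= !andbT => x0 y0 xy.
  exact: lee_pmul.
- exact/measurable_EFinP.
- by under eq_integral do rewrite /= -EFinM -normrM -expr2 ger0_norm ?sqr_ge0//.
Qed.

End SecondMoment.

(** * Laws on a bounded interval *)

Section BoundedLaw.
Variables (R : realType) (nu : probability R R) (b mu : R).

(** Clamping makes an almost surely bounded variable bounded everywhere, so that
    it is integrable and the second moment estimate applies. *)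
Definition clamp (x : R) : R := Num.max 0 (Num.min x b).

Lemma measurable_clamp : measurable_fun setT clamp.
Proof.
by apply: measurable_maxr => //; exact: measurable_minr.
Qed.

Lemma clamp_id x : 0 <= x <= b -> clamp x = x.
Proof. by move=> /andP[x0 xb]; rewrite /clamp min_l// max_r. Qed.

Hypothesis b0 : 0 <= b.

Lemma clamp_itv x : 0 <= clamp x <= b.
Proof. by rewrite /clamp le_max lexx /= ge_max b0 ge_min lexx orbT. Qed.

Hypothesis nu_mean : (\int[nu]_x (clamp x)%:E = mu%:E)%E.

Let clamp_integrable : nu.-integrable setT (EFin \o clamp).
Proof.
apply: measurable_bounded_integrable => //.
- by apply: le_lt_trans (ltry 1); exact: probability_le1.
- exact: measurable_clamp.
exists b; split; first exact: num_real.
move=> M bM x _ /=; have /andP[c0 cb] := clamp_itv x.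
by rewrite ger0_norm// (le_trans cb)// ltW.
Qed.

Lemma integral_clamp_sub c : (\int[nu]_x (clamp x - c)%:E = (mu - c)%:E)%E.
Proof.
have cI : nu.-integrable setT (cst c%:E).
  exact: finite_measure_integrable_cst.
under eq_integral do rewrite EFinB.
rewrite (integralB measurableT clamp_integrable cI) nu_mean.
by rewrite integral_cst//= probability_setT mule1.
Qed.

Lemma mean_le_bound : mu <= b.
Proof.
rewrite -lee_fin -nu_mean.
have -> : b%:E = (\int[nu]_x cst b%:E x)%E.
  by rewrite integral_cst//= probability_setT mule1.
apply: ge0_le_integral => //.
- by move=> x _; rewrite lee_fin; case/andP: (clamp_itv x).
- by apply/measurable_EFinP; exact: measurable_clamp.
- by move=> x _; rewrite lee_fin; case/andP: (clamp_itv x).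
Qed.

(** Both the clamped value and the mean lie between [0] and [b]. *)
Lemma clamp_sub_mean_le x : 0 <= mu -> `|clamp x - mu| <= b.
Proof.
move=> mu0; have /andP[c0 cb] := clamp_itv x; have mub := mean_le_bound.
by rewrite ler_norml; apply/andP; split; lra.
Qed.

(** The nonnegative function [b - clamp x] has integral [b - mu = 0], hence
    vanishes almost everywhere. *)
Lemma mean_eq_bound_ae : nu (~` `[0, b]) = 0%E -> mu = b ->
  nu (~` [set b]) = 0%E.
Proof.
move=> nu0b mub.
have mD : measurable_fun setT (fun x => (b - clamp x)%:E).
  apply/measurable_EFinP; apply: measurable_funB => //.
  exact: measurable_clamp.
have /(ae_eq_integral_abs nu measurableT mD) clampb :
    (\int[nu]_x `|(b - clamp x)%:E| = 0)%E.
  under eq_integral do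
    rewrite gee0_abs ?lee_fin ?subr_ge0 ?(andP (clamp_itv _)).2//.
  under eq_integral do rewrite EFinB.
  have bI : nu.-integrable setT (cst b%:E).
    exact: finite_measure_integrable_cst.
  rewrite (integralB measurableT bI clamp_integrable) nu_mean.
  by rewrite integral_cst//= probability_setT mule1 mub subee.
apply: measure_negligible; first exact: measurableC.
have : nu.-negligible (~` `[0, b]).
  by apply/negligibleP => //; exact: measurableC.
move=> /(negligibleU clampb); apply: negligibleS => x /= xb.
have [x0b|x0b] := boolP (0 <= x <= b); [left|right]; last first.
  by rewrite /= in_itv /=; exact/negP.
move=> /(_ I) [] /eqP; rewrite clamp_id// subr_eq0 => /eqP bx.
exact: xb.
Qed.

End BoundedLaw.

(** * The uniform law of large numbers for an array *)

Lemma notin_finite_union T (I : finType) (B : I -> set T) x :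
  ~ (\big[setU/set0]_i B i) x -> forall i, ~ B i x.
Proof. by move=> BNx i Bix; apply: BNx; rewrite (bigD1 i)//=; left. Qed.

Section IidArray.
Variables (R : realType) (nu : probability R R) (b mu : R).
Hypotheses (b0 : 0 <= b) (mu0 : 0 <= mu).
Hypothesis nu_mean : (\int[nu]_x (clamp b x)%:E = mu%:E)%E.
Variables (d : measure_display) (W : measurableType d) (P : probability W R).
Variables (r n : nat) (Y : 'I_r.+1 -> 'I_n.+1 -> {RV P >-> R}).
Hypothesis ident : forall i j A, measurable A -> P (Y i j @^-1` A) = nu A.
Hypothesis indep : forall i j j' A B, j != j' ->
  measurable A -> measurable B ->
  P (Y i j @^-1` A `&` Y i j' @^-1` B) = (nu A * nu B)%E.

Definition some_entry_outside (D : set R) : set W :=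
  \big[setU/set0]_(ij : 'I_r.+1 * 'I_n.+1) (Y ij.1 ij.2 @^-1` (~` D)).

Lemma some_entry_outside_null (D : set R) : measurable D ->
  nu (~` D) = 0%E -> P (some_entry_outside D) = 0%E.
Proof.
move=> mD nuD; apply/eqP; rewrite -measure_le0.
apply: le_trans (probability_finite_union_le _ _) _ => [[i j]|].
  by apply: measurable_funPTI => //; exact: measurableC.
rewrite big1// => -[i j] _ /=; rewrite ident//; exact: measurableC.
Qed.

Lemma measurable_some_entry_outside (D : set R) : measurable D ->
  measurable (some_entry_outside D).
Proof.
move=> mD; apply: bigsetU_measurable => -[i j] _.
by apply: measurable_funPTI => //; exact: measurableC.
Qed.

Definition some_sum_deviates (K B : nat) (e : R) : set W :=
  \big[setU/set0]_(il : 'I_r.+1 * 'I_K.+1)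
    [set w | e <= `|partial_sum (fun j => clamp b (Y il.1 j w) - mu)
                                (il.2 * B)|].

Let measurable_deviation i k e :
  measurable [set w | e <= `|partial_sum (fun j => clamp b (Y i j w) - mu) k|].
Proof.
rewrite -[X in measurable X]setTI.
apply: (measurable_fun_le measurableT) => //.
apply: measurableT_comp => //; apply: measurable_finsum => j.
apply: measurable_funB => //.
by apply: measurableT_comp => //; exact: measurable_clamp.
Qed.

Lemma measurable_some_sum_deviates K B e :
  measurable (some_sum_deviates K B e).
Proof. by apply: bigsetU_measurable => -[i l] _. Qed.

Lemma some_sum_deviates_le K B e : 0 < e ->
  (P (some_sum_deviates K B e)
   <= ((r.+1 * K.+1)%:R * (n.+1%:R * b ^+ 2 / e ^+ 2))%:E)%E.
Proof.
move=> e0; apply: le_trans (probability_finite_union_le _ _) _ => [[i l]//|].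
have -> : (r.+1 * K.+1)%N = #|{: 'I_r.+1 * 'I_K.+1}|.
  by rewrite card_prod !card_ord.
rewrite mulr_natl -sumr_const -sumEFin; apply: lee_sum => -[i l] _ /=.
rewrite -[X in X%:R](card_ord n.+1).
apply: (@chebyshev_sum_le _ _ _ P nu (fun x => clamp b x - mu)) => //.
- by apply: measurable_funB => //; exact: measurable_clamp.
- by move=> x; exact: (clamp_sub_mean_le b0 nu_mean).
- by rewrite (integral_clamp_sub b0 nu_mean) subrr.
- by move=> j j' A B' jj'; exact: indep.
Qed.

(** Off the first event the clamped entries are the entries themselves, and the
    second event bounds their centred sums on the grid. *)
Lemma typical_off_bad_events K e w :
  let B := (n.+1 %/ K.+1).+1 in
  ~ some_entry_outside `[0, b] w -> ~ some_sum_deviates K B e w ->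
  typical b mu (e + B%:R * b) (fun i j => Y i j w).
Proof.
move=> B wb wdev.
have Yin := notin_finite_union wb; have Ydev := notin_finite_union wdev.
have Yb i j : 0 <= Y i j w <= b.
  by have /contrapT := Yin (i, j); rewrite /= in_itv.
split=> // i; apply: partial_sum_grid => [j|l].
  by rewrite -(clamp_id (Yb i j)); exact: (clamp_sub_mean_le b0 nu_mean).
have := Ydev (i, l) => /= /negP; rewrite -ltNge => /ltW.
by under eq_fun do rewrite (clamp_id (Yb _ _)).
Qed.

End IidArray.

(** * The limit theorem for arrays *)

Section Limit.
(* the index [n] of the families [Y], [opt] and [lb] stays explicit *)
Unset Implicit Arguments.
Variables (R : realType) (nu : probability R R) (b mu : R).
Hypotheses (b0 : 0 <= b) (mu0 : 0 < mu).
Hypothesis nu_itv : nu (~` `[0, b]) = 0%E.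
Hypothesis nu_mean : (\int[nu]_x (clamp b x)%:E = mu%:E)%E.
Variables (d : nat -> measure_display) (W : forall n, measurableType (d n)).
Variables (P : forall n, probability (W n) R).
Variables (r : nat) (Y : forall n, 'I_r.+1 -> 'I_n.+1 -> {RV (P n) >-> R}).
Hypothesis ident : forall n i j A, measurable A -> P n (Y n i j @^-1` A) = nu A.
Hypothesis indep : forall n i j j' A B, j != j' ->
  measurable A -> measurable B ->
  P n (Y n i j @^-1` A `&` Y n i j' @^-1` B) = (nu A * nu B)%E.
Variables opt lb : forall n, W n -> R.
Hypothesis mopt : forall n, measurable_fun setT (opt n).
Hypothesis mlb : forall n, measurable_fun setT (lb n).
Hypothesis opt_lb :
  forall n w, flow_bounds (fun i j => Y n i j w) (opt n w) (lb n w).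

Let E n : set (W n) := [set w | opt n w <= b / mu * lb n w].

Let mE n : measurable (E n).
Proof.
rewrite -[X in measurable X]setTI.
by apply: (measurable_fun_le measurableT) => //; exact: measurable_funM.
Qed.

(** With [e = eps * n.+1] and blocks of length at most [n.+1 / K.+1 + 1], the
    array is typical up to [e + B * b <= 2 * eps * n.+1 + b] as soon as
    [b <= eps * K.+1].  The choice of [eps] makes the linear part cost half of
    the gain [n.+1 * (b - mu)]; the other half covers the constants for large
    [n].  [K] does not depend on [n], so the failure probability is O(1/n). *)
Lemma approximation_cvg1 : (fun n => P n (E n)) @ \oo --> 1%E.
Proof.
have := mean_le_bound b0 nu_mean; rewrite le_eqVlt => /predU1P[mub|mub].
  apply: (@probability_cvg1 _ _ _ _ _
    (fun n => some_entry_outside (Y n) [set b]) 0) => //.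
    by move=> n; exact: measurable_some_entry_outside.
  apply: nearW => n; split; last first.
    rewrite mul0r (@some_entry_outside_null _ nu)//; first exact: ident.
    exact: (mean_eq_bound_ae b0 nu_mean).
  move=> w /= Ew; apply: contrapT => wb; apply: Ew.
  have Yb := notin_finite_union wb.
  rewrite /E /= mub divff ?gt_eqF ?(lt_le_trans mu0) ?mub// mul1r.
  apply: (constant_opt_le b0 (opt_lb n w)) => i j.
  exact: (contrapT (Yb (i, j))).
pose c : R := b / mu + 1 + 2 * r%:R.
have c0 : 0 < c.
  by rewrite /c ltr_wpDr ?mulr_ge0// ltr_wpDl// divr_ge0// ltW.
pose eps : R := (b - mu) / (4 * c).
have eps0 : 0 < eps by rewrite divr_gt0 ?subr_gt0 ?mulr_gt0.
pose K := Num.truncn (b / eps).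
have Kb : b <= eps * K.+1%:R.
  by rewrite mulrC -ler_pdivrMr// ltW// truncnS_gt.
pose B n := (n.+1 %/ K.+1).+1.
apply: (@probability_cvg1 _ _ _ _ _
  (fun n => some_entry_outside (Y n) `[0, b] `|`
            some_sum_deviates b mu (Y n) K (B n) (eps * n.+1%:R))
  ((r.+1 * K.+1)%:R * (b ^+ 2 / eps ^+ 2))) => //.
  move=> n; apply: measurableU; first exact: measurable_some_entry_outside.
  exact: measurable_some_sum_deviates.
near=> n; split; last first.
  apply: le_trans (measureU2 (P n) _ _) _.
  - exact: measurable_some_entry_outside.
  - exact: measurable_some_sum_deviates.
  have Pb : (P n (some_entry_outside (Y n) `[0%R, b]) <= 0)%E.
    by rewrite (some_entry_outside_null (ident n)).
  have Pdev := some_sum_deviates_le b0 (ltW mu0) nu_mean (indep n) K (B n)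
    (mulr_gt0 eps0 (ltr0Sn R n)).
  apply: le_trans (leeD Pb Pdev) _; rewrite add0e.
  have N0 : n.+1%:R != 0 :> R by [].
  rewrite lee_fin le_eqVlt; apply/orP; left; apply/eqP.
  move: n.+1%:R N0 => N N0; move: (_ * _)%:R => k.
  by field; rewrite N0 gt_eqF.
move=> w /= Ew; apply: contrapT => /not_orP[Yb Ydev]; apply: Ew.
have := typical_off_bad_events b0 (ltW mu0) nu_mean Yb Ydev.
move=> /(typical_opt_le mu0 (opt_lb n w)); apply.
(* the constants [c * b] and [r * b] fit into the other half of the gain *)
have N_large : c * b + r%:R * b <= n.+1%:R * ((b - mu) / 2).
  rewrite -ler_pdivrMr ?divr_gt0 ?subr_gt0//.
  have : (c * b + r%:R * b) / ((b - mu) / 2) <= n%:R.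
    by near: n; exact: nbhs_infty_ger.
  by move=> /le_trans; apply; rewrite ler_nat.
have BN : (B n)%:R * b <= eps * n.+1%:R + b.
  rewrite /B mulrSr mulrDl mul1r lerD2r.
  apply: le_trans (ler_wpM2l _ Kb) _ => //.
  by rewrite mulrCA ler_wpM2l ?(ltW eps0)// -natrM ler_nat leq_divM.
have ceps : c * eps = (b - mu) / 4 by rewrite /eps; field; rewrite gt_eqF.
have : c * (eps * n.+1%:R + (B n)%:R * b)
    <= c * (eps * n.+1%:R + (eps * n.+1%:R + b)).
  by rewrite ler_wpM2l ?(ltW c0)// lerD2l.
have -> : c * (eps * n.+1%:R + (eps * n.+1%:R + b))
    = 2 * (c * eps) * n.+1%:R + c * b by ring.
rewrite ceps => cE; apply: le_trans (lerD cE (lexx _)) _.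
by move: n.+1%:R N_large => N N_large; lra.
Unshelve. all: end_near.
Qed.

End Limit.

Set Implicit Arguments.

(** * Independence and law of the processing times *)

Lemma mutually_independent_pair d (W : measurableType d) (R : realType)
    (P : probability W R) (I : finType) (X : I -> {RV P >-> R}) i j A B :
  mutually_independent X -> i != j -> measurable A -> measurable B ->
  P (X i @^-1` A `&` X j @^-1` B) = (P (X i @^-1` A) * P (X j @^-1` B))%E.
Proof.
move=> indep ij mA mB; pose D k := if k == i then A else B.
have Dj : D j = B by rewrite /D eq_sym (negbTE ij).
have Di : D i = A by rewrite /D eqxx.
have mD k : measurable (D k) by rewrite /D; case: ifP.
have := indep [set i; j]%SET D mD.
rewrite big_setU1/= ?big_set1 ?inE// Dj Di => <-; congr (P _).
apply/seteqP; split=> [w [Aw Bw] k|w Dw].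
  by rewrite !inE => /orP[/eqP->|/eqP->]; rewrite ?Di ?Dj.
split; rewrite /preimage /=.
  by rewrite -Di; apply: Dw; rewrite !inE eqxx.
by rewrite -Dj; apply: Dw; rewrite !inE eqxx orbT.
Qed.

Section SupportedLaw.
Variables (R : realType) (d : measure_display) (W : measurableType d).
Variables (Q : probability W R) (T : {RV Q >-> R}) (a b mu : R).
Hypotheses (a0 : 0 <= a) (T_mean : ('E_Q[T] = mu%:E)%E).
Hypothesis T_supp : support_of (distribution Q T) `<=` `[a, b].

Lemma law_outside_null : distribution Q T (~` `[a, b]) = 0%E.
Proof.
apply: support_of_null.
  by apply: closed_openC; exact: itv_closed.
by apply/seteqP; split=> // x [xab /T_supp].
Qed.

(** Otherwise the interval is empty and the total mass is zero. *)
Lemma bound_ge0 : 0 <= b.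
Proof.
rewrite leNgt; apply/negP => b_lt0.
have := law_outside_null; rewrite set_itv_ge ?setC0.
  by rewrite probability_setT => /eqP; rewrite onee_eq0.
by rewrite bnd_simp -ltNge (lt_le_trans b_lt0).
Qed.

Lemma law_outside0_null : distribution Q T (~` `[0, b]) = 0%E.
Proof.
apply/eqP; rewrite -measure_le0 -law_outside_null; apply: le_measure.
- by rewrite inE; exact: measurableC.
- by rewrite inE; exact: measurableC.
- apply: subsetC => x /=; rewrite !in_itv /= => /andP[ax ->].
  by rewrite (le_trans a0).
Qed.

(** Almost surely [T] equals its clamped version. *)
Lemma law_mean : (\int[distribution Q T]_x (clamp b x)%:E = mu%:E)%E.
Proof.
have mc := measurable_clamp b.
rewrite ge0_integral_distribution; last 2 first.
- exact/measurable_EFinP.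
- by move=> x; rewrite lee_fin; case/andP: (clamp_itv bound_ge0 x).
rewrite -T_mean expectation_def; apply: ae_eq_integral => //.
- by apply/measurable_EFinP; exact: measurableT_comp.
- exact/measurable_EFinP.
have : Q.-negligible (T @^-1` (~` `[0, b])).
  apply/negligibleP; last exact: law_outside0_null.
  by apply: measurable_funPTI; exact: measurableC.
apply: negligibleS => w /= Tw; rewrite in_itv /= => Tb; apply: Tw => _.
by rewrite clamp_id.
Qed.

End SupportedLaw.

(** * Both limits *)

(* N_0 = n0.+1 and M_0 = m0.+1; the sequences are indexed by n and m, with
   N = n.+1 and M = m.+1.  Each random instance may live on its own
   probability space. *)
Theorem corollary10 (R : realType) (n0 m0 : nat)
    (d0 : measure_display) (W0 : measurableType d0) (Q : probability W0 R)
    (T : {RV Q >-> R}) (a b mu : R)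
    (ha : 0 <= a)
    (hsupp : support_of (distribution Q T) `<=` `[a, b])
    (hmean : ('E_Q[T] = mu%:E)%E)
    (hmu : 0 < mu) :
  (forall (d : nat -> measure_display) (W : forall n, measurableType (d n))
      (P : forall n, probability (W n) R)
      (X : forall n, 'I_m0.+1 -> 'I_n.+1 -> {RV (P n) >-> R}),
    (forall n, random_instance T (X n)) ->
    (fun n => P n [set w | b / mu * LBMplus (outcome (X n) w)
                           >= OPT (outcome (X n) w)]) @ \oo --> 1%E)
  /\
  (forall (d : nat -> measure_display) (W : forall m, measurableType (d m))
      (P : forall m, probability (W m) R)
      (X : forall m, 'I_m.+1 -> 'I_n0.+1 -> {RV (P m) >-> R}),
    (forall m, random_instance T (X m)) ->
    (fun m => P m [set w | b / mu * LBJplus (outcome (X m) w)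
                           >= OPT (outcome (X m) w)]) @ \oo --> 1%E).
Proof.
have b0 := bound_ge0 ha hsupp.
have nu_itv := law_outside0_null ha hsupp.
have nu_mean := law_mean ha hmean hsupp.
have moutcome d (W : measurableType d) (P : probability W R) m n
    (X : 'I_m.+1 -> 'I_n.+1 -> {RV P >-> R}) i j :
    measurable_fun setT (fun w => outcome X w i j).
  by under eq_fun do rewrite mxE; exact: measurable_funPT.
split=> d W P X XI.
- apply: (@approximation_cvg1 _ _ _ _ b0 hmu nu_itv nu_mean _ _ _ _ X).
  + by move=> n i j A mA; exact: (XI n).2.
  + move=> n i j j' A B jj' mA mB.
    rewrite (mutually_independent_pair (i := (i, j)) (j := (i, j')) (XI n).1)//.
      by congr (_ * _)%E; exact: (XI n).2.
    by rewrite xpair_eqE eqxx.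
  + by move=> n; apply: measurable_OPT => i j; exact: moutcome.
  + by move=> n; apply: measurable_LBMplus => i j; exact: moutcome.
  + move=> n w; rewrite (_ : (fun i j => X n i j w)
        = (fun i j => outcome (X n) w i j)); first exact: flow_bounds_LBMplus.
    by apply/funext => i; apply/funext => j; rewrite mxE.
- apply: (@approximation_cvg1 _ _ _ _ b0 hmu nu_itv nu_mean _ _ _ _
    (fun m j i => X m i j)).
  + by move=> n i j A mA; exact: (XI n).2.
  + move=> n i j j' A B jj' mA mB.
    rewrite (mutually_independent_pair (i := (j, i)) (j := (j', i)) (XI n).1)//.
      by congr (_ * _)%E; exact: (XI n).2.
    by rewrite xpair_eqE eqxx andbT.
  + by move=> n; apply: measurable_OPT => i j; exact: moutcome.
  + by move=> n; apply: measurable_LBJplus => i j; exact: moutcome.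
  + move=> n w; rewrite (_ : (fun j i => X n i j w)
        = (fun j i => outcome (X n) w i j)); first exact: flow_bounds_LBJplus.
    by apply/funext => j; apply/funext => i; rewrite mxE.
Qed.
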